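(* Let $\mathbb{C}$ be a category with finite products in which product projections are pushout stable. Then $\mathbb{C}$ is co-Boolean if and only if every object of $\mathbb{C}$ is projection-coextensive.
   Context: A product projection of $X$ is a morphism $X\to A$ that is one of the two legs of some binary product diagram $A\leftarrow X\to A'$. Product projections are pushout stable if for every product projection $p:X\to A$ and every morphism $f:X\to Y$ the pushout of $p$ along $f$ exists and the resulting morphism $Y\to P$ into the pushout object is a product projection. A category $\mathbb{C}$ with finite products is co-Boolean if: (1) for every product projection $p:X\to A$ and any morphism $f:X\to Y$ there exists a pushout of $p$ along $f$, with pushout object $P$, such that the resulting morphism $q:Y\to P$ is a product projection; (2) product projections push out product diagrams to product diagrams, i.e. if $A_1\leftarrow X\to A_2$ is a product diagram and $f:X\to Y$ is a product projection, then pushing out both legs along $f$ yields a product diagram $P_1\leftarrow Y\to P_2$; (3) if $X\xleftarrow{1_X}X\xrightarrow{1_X}X$ is a product diagram, then $X$ is a terminal object. For a class $\mathcal{M}$ of morphisms, an $\mathcal{M}$-pushout is a pushout square whose two morphisms into the pushout object belong to $\mathcal{M}$. An object $X$ is $\mathcal{M}$-coextensive if every morphism in $\mathcal{M}$ with domain $X$ admits an $\mathcal{M}$-pushout along every product projection of $X$, and for every commutative diagram consisting of a product diagram $A_1\leftarrow X\to A_2$ (top row), a bottom row $B_1\leftarrow Y\to B_2$, and vertical morphisms $A_1\to B_1$, $X\to Y$, $A_2\to B_2$ all in $\mathcal{M}$, the bottom row is a product diagram if and only if both squares are $\mathcal{M}$-pushouts. $X$ is projection-coextensive if it is $\mathcal{M}$-coextensive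 with $\mathcal{M}$ the class of all product projections in $\mathbb{C}$. *)

(* Defs.v *)
From mathcomp Require Import all_boot.

Set Implicit Arguments.
Unset Strict Implicit.
Unset Printing Implicit Defensive.

Record category := Category {
  obj :> Type;
  hom : obj -> obj -> Type;
  idm : forall X, hom X X;
  compm : forall X Y Z, hom Y Z -> hom X Y -> hom X Z;
  comp_idl : forall X Y (f : hom X Y), compm (idm Y) f = f;
  comp_idr : forall X Y (f : hom X Y), compm f (idm X) = f;
  compA : forall W X Y Z (h : hom Y Z) (g : hom X Y) (f : hom W X),
    compm h (compm g f) = compm (compm h g) f
}.

Arguments hom {c} X Y.
Arguments idm {c} X.
Arguments compm {c X Y Z} g f.

(* Composition in applicative order: first f, then g. *)
Notation "g '\oc' f" := (compm g f) (at level 40, left associativity).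

Section Diagrams.
Variable C : category.

Definition is_terminal (X : C) : Prop :=
  forall T : C, exists t : hom T X, forall s : hom T X, s = t.

Definition is_product (I : finType) (A : I -> C) (P : C)
    (p : forall i, hom P (A i)) : Prop :=
  forall (T : C) (t : forall i, hom T (A i)),
    exists! u : hom T P, forall i, p i \oc u = t i.

(* The empty family, I = void, gives a terminal object. *)
Definition has_finite_products : Prop :=
  forall (I : finType) (A : I -> C),
    exists (P : C) (p : forall i, hom P (A i)), is_product p.

(* A1 <-p1- X -p2-> A2 is a binary product diagram. *)
Definition product_diagram (X A1 A2 : C) (p1 : hom X A1) (p2 : hom X A2) :
    Prop :=
  forall (T : C) (t1 : hom T A1) (t2 : hom T A2),
    exists! u : hom T X, p1 \oc u = t1 /\ p2 \oc u = t2.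

(* The notion of product diagram is symmetric in its two legs, so it is enough
   to let the projection be the first one. *)
Definition product_projection (X A : C) (p : hom X A) : Prop :=
  exists (A' : C) (p' : hom X A'), product_diagram p p'.

(* The square        f
                X ------> Y
              g |         | i
                v         v
                Z ------> P
                     j            *)
Definition pushout (X Y Z P : C) (f : hom X Y) (g : hom X Z)
    (i : hom Y P) (j : hom Z P) : Prop :=
  i \oc f = j \oc g /\
  forall (T : C) (u : hom Y T) (v : hom Z T), u \oc f = v \oc g ->
    exists! t : hom P T, t \oc i = u /\ t \oc j = v.

Definition projections_pushout_stable : Prop :=
  forall (X A : C) (p : hom X A), product_projection p ->
  forall (Y : C) (f : hom X Y),
    exists (P : C) (r : hom A P) (q : hom Y P),
      pushout p f r q /\ product_projection q.

Definition projections_preserve_products : Prop :=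
  forall (X A1 A2 Y : C) (p1 : hom X A1) (p2 : hom X A2) (f : hom X Y),
    product_diagram p1 p2 -> product_projection f ->
  forall (P1 P2 : C) (r1 : hom A1 P1) (q1 : hom Y P1)
         (r2 : hom A2 P2) (q2 : hom Y P2),
    pushout p1 f r1 q1 -> pushout p2 f r2 q2 -> product_diagram q1 q2.

Definition co_Boolean : Prop :=
  [/\ projections_pushout_stable,
      projections_preserve_products
    & forall X : C, product_diagram (idm X) (idm X) -> is_terminal X].

Definition morphism_class := forall X Y : C, hom X Y -> Prop.

Definition M_pushout (M : morphism_class) (X Y Z P : C)
    (f : hom X Y) (g : hom X Z) (i : hom Y P) (j : hom Z P) : Prop :=
  [/\ pushout f g i j, M Y P i & M Z P j].

Definition M_coextensive (M : morphism_class) (X : C) : Prop :=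
  (forall (Y : C) (m : hom X Y), M X Y m ->
   forall (A : C) (p : hom X A), product_projection p ->
     exists (P : C) (i : hom A P) (j : hom Y P), M_pushout M p m i j)
  /\
  (forall (A1 A2 Y B1 B2 : C)
          (p1 : hom X A1) (p2 : hom X A2)
          (q1 : hom Y B1) (q2 : hom Y B2)
          (m1 : hom A1 B1) (m : hom X Y) (m2 : hom A2 B2),
     product_diagram p1 p2 ->
     M A1 B1 m1 -> M X Y m -> M A2 B2 m2 ->
     m1 \oc p1 = q1 \oc m -> m2 \oc p2 = q2 \oc m ->
     (product_diagram q1 q2 <->
      M_pushout M p1 m m1 q1 /\ M_pushout M p2 m m2 q2)).

Definition projection_coextensive (X : C) : Prop :=
  M_coextensive product_projection X.

End Diagrams.

Arguments has_finite_products C : clear implicits.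
Arguments projections_pushout_stable C : clear implicits.
Arguments projections_preserve_products C : clear implicits.
Arguments co_Boolean C : clear implicits.

(* Main.v *)
(** In a co-Boolean category a product projection that is a split monomorphism
    is invertible.  Applied to the cokernel pair of a projection, this shows
    that projections are epic; the pushout [N] of the two legs of a product
    diagram then has [N <- N -> N] (identity legs) as a product diagram, so it
    is terminal.  If [Y = P1 x P2 = B1 x B2] with compatible maps
    [c1 : P1 -> B1] and [c2 : P2 -> B2], pushing the second diagram out along
    [Y -> P1] gives [P1 = B1 x Q], where [P1 -> Q] factors through the terminal
    pushout of [P1 <- Y -> P2]; hence [c1] is invertible.  With [P1] and [P2]
    the pushouts of the legs of a product diagram, this is
    projection-coextensivity.

    Conversely, if [X <- X -> X] (identity legs) is a product diagram, mapping
    it to the product diagram [X <- X -> 1] makes [X -> 1] a pushout of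
    identities, hence invertible. *)
From mathcomp Require Import all_boot.
Require Import Defs.

Set Implicit Arguments.
Unset Strict Implicit.
Unset Printing Implicit Defensive.

Section Category.
Variable C : category.
Implicit Types A B P Q T X Y Z N : C.

Lemma product_eq X A1 A2 (p1 : hom X A1) (p2 : hom X A2) T (u v : hom T X) :
  product_diagram p1 p2 ->
  p1 \oc u = p1 \oc v -> p2 \oc u = p2 \oc v -> u = v.
Proof.
move=> hp e1 e2; have [w [_ hw]] := hp T (p1 \oc v) (p2 \oc v).
by rewrite -(hw u) // -(hw v).
Qed.

Lemma product_diagramC X A1 A2 (p1 : hom X A1) (p2 : hom X A2) :
  product_diagram p1 p2 -> product_diagram p2 p1.
Proof.
move=> hp T t1 t2; have [u [[e1 e2] hu]] := hp T t2 t1.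
by exists u; split=> [//|v [f1 f2]]; apply: hu.
Qed.

Lemma product_projection1 X A1 A2 (p1 : hom X A1) (p2 : hom X A2) :
  product_diagram p1 p2 -> product_projection p1.
Proof. by exists A2, p2. Qed.

Lemma product_projection2 X A1 A2 (p1 : hom X A1) (p2 : hom X A2) :
  product_diagram p1 p2 -> product_projection p2.
Proof. by move=> /product_diagramC; apply: product_projection1. Qed.

Lemma product_projection_iso X P B (q : hom X P) (c : hom P B) (d : hom B P) :
  d \oc c = idm _ -> c \oc d = idm _ -> product_projection q ->
  product_projection (c \oc q).
Proof.
move=> dc cd [A' [q' hq]]; exists A', q' => T t1 t2.
have [u [[e1 e2] _]] := hq T (d \oc t1) t2; exists u; split.
  by rewrite -compA e1 compA cd comp_idl.
move=> v [f1 f2]; apply: (product_eq hq); last by rewrite e2 f2.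
by rewrite e1 -f1 !compA dc comp_idl.
Qed.

(** The map [p' \oc s] serves as a second component next to the identity of [A], so [p] has a right
    inverse [u], which must equal the left inverse [s]. *)
Lemma product_projection_split_mono X A (p : hom X A) (s : hom A X) :
  product_projection p -> s \oc p = idm _ -> p \oc s = idm _.
Proof.
move=> [A' [p' hp]] sp; have [u [[e1 _] _]] := hp A (idm _) (p' \oc s).
suff -> : s = u by [].
by rewrite -(comp_idl u) -sp -compA e1 comp_idr.
Qed.

Lemma pushout_eq X Y Z P (f : hom X Y) (g : hom X Z) (i : hom Y P)
    (j : hom Z P) T (u v : hom P T) :
  pushout f g i j -> u \oc i = v \oc i -> u \oc j = v \oc j -> u = v.
Proof.
move=> [e h] e1 e2; have [|w [_ hw]] := h T (v \oc i) (v \oc j).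
  by rewrite -!compA e.
by rewrite -(hw u) // -(hw v).
Qed.

Lemma pushoutC X Y Z P (f : hom X Y) (g : hom X Z) (i : hom Y P)
    (j : hom Z P) :
  pushout f g i j -> pushout g f j i.
Proof.
move=> [e h]; split=> // T u v /esym /h[t [[e1 e2] ht]].
by exists t; split=> [//|w [f1 f2]]; apply: ht.
Qed.

Lemma pushout_iso X Y Z P B (f : hom X Y) (g : hom X Z) (i : hom Y P)
    (j : hom Z P) (c : hom P B) (d : hom B P) :
  d \oc c = idm _ -> c \oc d = idm _ -> pushout f g i j ->
  pushout f g (c \oc i) (c \oc j).
Proof.
move=> dc cd [e h]; split=> [|T u v /h[t [[e1 e2] ht]]].
  by rewrite -!compA e.
exists (t \oc d); split.
  by rewrite !compA -(compA t d) dc comp_idr.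
move=> w [f1 f2]; rewrite (ht (w \oc c)) -?compA ?cd ?comp_idr //.
Qed.

Lemma pushout_unique X Y Z P P' (f : hom X Y) (g : hom X Z) (i : hom Y P)
    (j : hom Z P) (i' : hom Y P') (j' : hom Z P') :
  pushout f g i j -> pushout f g i' j' ->
  exists (c : hom P P') (d : hom P' P),
    [/\ d \oc c = idm _, c \oc d = idm _, c \oc i = i' & c \oc j = j'].
Proof.
move=> h h'; have [e u] := h; have [e' u'] := h'.
have [c [[c1 c2] _]] := u _ _ _ e'; have [d [[d1 d2] _]] := u' _ _ _ e.
exists c, d; split=> //.
- by apply: (pushout_eq h); rewrite -compA ?c1 ?c2 comp_idl.
- by apply: (pushout_eq h'); rewrite -compA ?d1 ?d2 comp_idl.
Qed.

(** Stability supplies one pushout whose leg is a projection; any other differs from it by an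
    isomorphism. *)
Lemma product_projection_pushout X A Y P (p : hom X A) (f : hom X Y)
    (r : hom A P) (q : hom Y P) :
  projections_pushout_stable C -> product_projection p -> pushout p f r q ->
  product_projection q.
Proof.
move=> hst hp h; have [P' [r' [q' [h' hq']]]] := hst _ _ _ hp _ f.
have [c [d [dc cd _ <-]]] := pushout_unique h' h.
exact: product_projection_iso dc cd hq'.
Qed.

(** Cancelling the epimorphism [f] turns [u \oc (c \oc f) = v \oc f] into [u \oc c = v]. *)
Lemma pushout_epi X Y P (f : hom X Y) (c : hom Y P) :
  (forall T (u v : hom Y T), u \oc f = v \oc f -> u = v) ->
  pushout (c \oc f) f (idm _) c.
Proof.
move=> f_epi; split=> [|T u v e]; first by rewrite comp_idl.
exists u; split=> [|w [<- _]]; last by rewrite comp_idr.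
by split; [rewrite comp_idr|apply: f_epi; rewrite -compA].
Qed.

Lemma product_projection_epi X A (p : hom X A) :
  projections_pushout_stable C -> product_projection p ->
  forall T (u v : hom A T), u \oc p = v \oc p -> u = v.
Proof.
move=> hst hp T u v e; have [P [r [q [[_ h] hq]]]] := hst _ _ _ hp _ p.
(* The codiagonal [t] splits the projection [q], so it is inverse to [q]; as [t] also splits [r],
   the two legs agree. *)
have [t [[tr tq] _]] := h A (idm _) (idm _) erefl.
have qt := product_projection_split_mono hq tq.
have rq : r = q by rewrite -(comp_idl r) -qt -compA tr comp_idr.
by have [w [[<- <-] _]] := h T u v e; rewrite rq.
Qed.

Lemma terminal_object : has_finite_products C -> exists N, is_terminal N.
Proof.
move=> hprod; have [N [p hN]] := hprod void (fun i => match i with end).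
exists N => T; have [t [_ ht]] := hN T (fun i => match i with end).
by exists t => s; rewrite (ht s) // => -[].
Qed.

Lemma binary_product A B : has_finite_products C ->
  exists P (p1 : hom P A) (p2 : hom P B), product_diagram p1 p2.
Proof.
move=> hprod; have [P [p hP]] := hprod bool (fun b => if b then A else B).
exists P, (p true), (p false) => T t1 t2.
have [u [hu uu]] := hP T (fun b => if b return hom T (if b then A else B)
                                  then t1 else t2).
exists u; split; first by split; [apply: (hu true)|apply: (hu false)].
by move=> v [e1 e2]; apply: uu => -[].
Qed.

Lemma product_diagram_terminal X N (t : hom X N) :
  is_terminal N -> product_diagram (idm X) t.
Proof.
move=> hN T t1 t2; exists t1; split=> [|u [<- _]]; last by rewrite comp_idl.
by rewrite comp_idl; have [s hs] := hN T; rewrite (hs t2) -(hs (t \oc t1)).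
Qed.

Lemma product_projection_comp X A B (p : hom X A) (q : hom A B) :
  has_finite_products C -> product_projection p -> product_projection q ->
  product_projection (q \oc p).
Proof.
move=> hprod [A' [p' hp]] [B' [q' hq]].
(* The complementary factor of the composite is the product of [B'] and [A']. *)
have [P [a [b hP]]] := binary_product B' A' hprod.
have [w [[wa wb] _]] := hP X (q' \oc p) p'.
exists P, w => T t1 t2.
have [u [[u1 u2] _]] := hq T t1 (a \oc t2).
have [v [[v1 v2] _]] := hp T u (b \oc t2).
exists v; split.
  split; first by rewrite -compA v1.
  by apply: (product_eq hP); rewrite compA ?wa ?wb // -compA v1.
move=> v' [e1 e2]; apply: (product_eq hp).
  rewrite v1; apply: (product_eq hq); first by rewrite u1 compA.
  by rewrite u2 -e2 !compA wa.
by rewrite v2 -e2 compA wb.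
Qed.

Lemma pushout_product_terminal Y A1 A2 N (p1 : hom Y A1) (p2 : hom Y A2)
    (r1 : hom A1 N) (r2 : hom A2 N) :
  has_finite_products C -> co_Boolean C ->
  product_diagram p1 p2 -> pushout p1 p2 r1 r2 -> is_terminal N.
Proof.
move=> hprod [hst hpres hid] hp h; have [e _] := h; apply: hid.
have hp1 := product_projection1 hp; have hp2 := product_projection2 hp.
have hr1 := product_projection_pushout hst hp2 (pushoutC h).
have hn := product_projection_comp hprod hp1 hr1.
(* Since projections are epic, pushing [p1] or [p2] out along the diagonal of the square gives the
   identity of [N]. *)
have h1 := pushoutC (pushout_epi r1 (product_projection_epi hst hp1)).
have h2 := pushoutC (pushout_epi r2 (product_projection_epi hst hp2)).
by rewrite -e in h2; apply: (hpres _ _ _ _ _ _ _ hp hn _ _ _ _ _ _ h1 h2).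
Qed.

Lemma product_comparison_iso Y P1 P2 B1 B2 (s1 : hom Y P1) (s2 : hom Y P2)
    (c1 : hom P1 B1) (c2 : hom P2 B2) :
  has_finite_products C -> co_Boolean C ->
  product_diagram s1 s2 -> product_diagram (c1 \oc s1) (c2 \oc s2) ->
  exists d : hom B1 P1, d \oc c1 = idm _ /\ c1 \oc d = idm _.
Proof.
move=> hprod hB hs hc; have [hst hpres _] := hB.
have hs1 := product_projection1 hs.
have [N [n1 [n2 [hN _]]]] := hst _ _ _ hs1 _ s2.
have Nterm := pushout_product_terminal hprod hB hs hN.
have [Q [d [x [hQ _]]]] := hst _ _ _ (product_projection2 hc) _ s1.
have hc1x : product_diagram c1 x.
  apply: (hpres _ _ _ _ _ _ _ hc hs1 _ _ _ _ _ _ _ hQ).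
  exact: pushout_epi (product_projection_epi hst hs1).
have [z [[zn1 _] _]] : exists! z, z \oc n1 = x /\ z \oc n2 = d \oc c2.
  by apply: hN.2; rewrite -compA hQ.1.
(* As [N] is terminal, [n1] factors through [c1], hence so does [x = z \oc n1]; the map with
   components [idm _] and [z \oc b] then inverts [c1]. *)
have [b _] := Nterm B1; have [a ha] := Nterm P1.
have zbc : (z \oc b) \oc c1 = x.
  by rewrite -compA (ha (b \oc c1)) -(ha n1).
have [u [[u1 u2] _]] := hc1x B1 (idm _) (z \oc b).
exists u; split=> //; apply: (product_eq hc1x).
  by rewrite compA u1 comp_idl comp_idr.
by rewrite compA u2 comp_idr.
Qed.

Lemma co_Boolean_projection_coextensive :
  has_finite_products C -> co_Boolean C ->
  forall X, projection_coextensive X.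
Proof.
move=> hprod hB X; have [hst hpres _] := hB; split.
  move=> Y m hm A p hp; have [P [i [j [h hj]]]] := hst _ _ _ hp _ m.
  exists P, i, j; split=> //.
  exact: product_projection_pushout hst hm (pushoutC h).
move=> A1 A2 Y B1 B2 p1 p2 q1 q2 m1 m m2 hp hm1 hm hm2 e1 e2; split; last first.
  move=> [[h1 _ _] [h2 _ _]].
  exact: (hpres _ _ _ _ _ _ _ hp hm _ _ _ _ _ _ h1 h2).
move=> hq.
(* The pushouts given by stability form a product diagram on [Y]; its comparison maps to the given
   row are invertible, so the given squares are pushouts too. *)
have [P1 [r1 [s1 [h1 _]]]] := hst _ _ _ (product_projection1 hp) _ m.
have [P2 [r2 [s2 [h2 _]]]] := hst _ _ _ (product_projection2 hp) _ m.
have hs : product_diagram s1 s2.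
  exact: (hpres _ _ _ _ _ _ _ hp hm _ _ _ _ _ _ h1 h2).
have [c1 [[c1r c1s] _]] := h1.2 _ _ _ e1.
have [c2 [[c2r c2s] _]] := h2.2 _ _ _ e2.
have hc : product_diagram (c1 \oc s1) (c2 \oc s2) by rewrite c1s c2s.
have [d1 [dc1 cd1]] := product_comparison_iso hprod hB hs hc.
have [d2 [dc2 cd2]] := product_comparison_iso hprod hB
  (product_diagramC hs) (product_diagramC hc).
have := pushout_iso dc1 cd1 h1; have := pushout_iso dc2 cd2 h2.
rewrite c1r c1s c2r c2s => h2' h1'; split; split=> //.
  exact: product_projection1 hq.
exact: product_projection2 hq.
Qed.

Lemma projection_coextensive_co_Boolean :
  has_finite_products C -> projections_pushout_stable C ->
  (forall X, projection_coextensive X) -> co_Boolean C.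
Proof.
move=> hprod hst hext; split=> //.
  move=> X A1 A2 Y p1 p2 f hp hf P1 P2 r1 q1 r2 q2 h1 h2.
  have hr1 := product_projection_pushout hst hf (pushoutC h1).
  have hr2 := product_projection_pushout hst hf (pushoutC h2).
  have hp1 := product_projection1 hp; have hp2 := product_projection2 hp.
  have hq1 := product_projection_pushout hst hp1 h1.
  have hq2 := product_projection_pushout hst hp2 h2.
  by apply/((hext X).2 _ _ _ _ _ _ _ _ _ _ _ _ hp hr1 hf hr2 h1.1 h2.1).
move=> X hX; have [N hN] := terminal_object hprod; have [t _] := hN X.
have hXN := product_diagram_terminal t hN.
have hid := product_projection1 hXN; have ht := product_projection2 hXN.
(* The vertical maps are [idm X], [idm X] and [t]; the right-hand square is the one kept. *)
have [_ [[_ h] _ _]] := ((hext X).2 _ _ _ _ _ _ _ _ _ _ _ _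
  hX hid hid ht (erefl _) (erefl _)).1 hXN.
(* The point [w : N -> X] gives every [T] a map to [X]; two maps [T -> X] coincide, being components
   of one map along two identities. *)
have [w _] := h X (idm _) (idm _) erefl.
move=> T; have [b _] := hN T; exists (w \oc b) => s.
have [v [[<- e] _]] := hX T s (w \oc b).
by rewrite -e.
Qed.

End Category.

Theorem mainTheorem4 (C : category)
    (hprod : has_finite_products C)
    (hstable : projections_pushout_stable C) :
  co_Boolean C <-> (forall X : C, projection_coextensive X).
Proof.
split; first exact: co_Boolean_projection_coextensive.
exact: projection_coextensive_co_Boolean.
Qed.
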